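(* Let $\vec G$ be an ordered digraph with active filtration $\emptyset=F'_\varepsilon\subset F'_{\varepsilon-1}\subset\cdots\subset F'_0=F_c=F_0\subset\cdots\subset F_{\iota-1}\subset F_\iota=E$, dual-active edges $a_1<\cdots<a_\iota$ and active edges $a'_1<\cdots<a'_\varepsilon$. Then the $\iota$ active minors $\vec G(F_k)/F_{k-1}$, $1\le k\le\iota$, are bipolar w.r.t. $a_k=\min(F_k\setminus F_{k-1})$, and the $\varepsilon$ active minors $\vec G(F'_{k-1})/F'_k$, $1\le k\le\varepsilon$, are cyclic-bipolar w.r.t. $a'_k=\min(F'_{k-1}\setminus F'_k)$.
   Context: Graphs are finite, may have loops and multiple edges, and are connected unless they arise as minors (isolated vertices are ignored). An ordered digraph has a linearly ordered edge set $E$; minors inherit the order. For $F\subseteq E$, $\vec G(F)$ is the restriction of $\vec G$ to $F$ (deletion of $E\setminus F$) and $\vec G/F$ is the contraction of $F$. Cycles and cocycles (inclusion-minimal non-empty edge cuts) are edge subsets. A cycle is directed if its edges are consistently oriented along it; a cocycle is directed if all its edges go from one side of the cut to the other. $\subset$ denotes strict inclusion. Dual-active edges of $\vec G$ are the smallest edges of directed cocycles, active edges the smallest edges of directed cycles. The active filtration of $\vec G$ is defined by: $F_c$ is the union of all directed cycles (equivalently the complement of the union of all directed cocycles); $F_\iota=E$ and $F_k=E\setminus\bigcup\{D\text{ directed cocycle}:\min(D)\ge a_{k+1}\}$ for $0\le k\le\iota-1$; $F'_\varepsilon=\emptyset$ and $F'_k=\bigcup\{C\text{ directed cycle}:\min(C)\ge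 a'_{k+1}\}$ for $0\le k\le\varepsilon-1$. The active minors of $\vec G$ are $\vec G(F_k)/F_{k-1}$ ($1\le k\le\iota$) and $\vec G(F'_{k-1})/F'_k$ ($1\le k\le\varepsilon$). A digraph is bipolar w.r.t. an edge $p$ if it is acyclic with a unique source and a unique sink, which are the extremities of $p$ (equivalently: every edge is in a directed cocycle and every directed cocycle contains $p$); in particular a single isthmus $p$ is bipolar. It is cyclic-bipolar w.r.t. $p$ if every edge is in a directed cycle and every directed cycle contains $p$ (equivalently: it is a single loop $p$, or it has at least two edges and reversing $p$ gives a digraph bipolar w.r.t. $p$). *)

(* Defs.v *)
From mathcomp Require Import all_boot all_order.
Set Implicit Arguments.
Unset Strict Implicit.
Unset Printing Implicit Defensive.

Import Order.TTheory.

(* The edges of a digraph form a subset of an ambient type [E], so that a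
   digraph and its minors have their edges in the same type; when [E] is
   totally ordered, every digraph on [E] is ordered and its minors inherit the
   order.  Vertices without incident edges are ignored throughout. *)
Record digraph (E : finType) := Digraph {
  vertex : finType;
  edges : {set E};
  src : E -> vertex;
  tgt : E -> vertex
}.

Section Digraphs.
Variable E : finType.
Implicit Types (G : digraph E) (A C D F : {set E}) (e p : E).

Definition adj G F : rel (vertex G) := fun x y =>
  [exists e in edges G :&: F,
     ((src G e == x) && (tgt G e == y)) || ((src G e == y) && (tgt G e == x))].
Arguments adj G F : clear implicits.

Definition nonisolated G (x : vertex G) :=
  [exists e in edges G, (src G e == x) || (tgt G e == x)].

Definition connected_digraph G :=
  [forall x : vertex G, forall y : vertex G,
     nonisolated x && nonisolated y ==> connect (adj G (edges G)) x y].

Definition restrict G F : digraph E :=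
  @Digraph E (vertex G) (edges G :&: F) (src G) (tgt G).

(* The vertices of G / F are the connected components of the spanning subgraph
   with edge set F, seen as sets of vertices of G; any other set of vertices is
   an isolated vertex. *)
Definition contract G F : digraph E :=
  @Digraph E {set vertex G} (edges G :\: F)
    (fun e => [set x | connect (adj G F) (src G e) x])
    (fun e => [set x | connect (adj G F) (tgt G e) x]).

(* The edges of C, suitably listed, form a closed directed walk that does not
   repeat any vertex. *)
Definition dicycle G C : bool :=
  [&& C != set0, C \subset edges G &
   [exists s : #|C|.-tuple E,
      [&& C == [set:: s], cycle (fun e f => tgt G e == src G f) s
        & uniq (map (src G) s)]]].

Definition cut G (X : {set vertex G}) : {set E} :=
  [set e in edges G | (src G e \in X) != (tgt G e \in X)].

Definition cocycle G D : bool :=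
  minset (fun A => (A != set0) && [exists X : {set vertex G}, A == cut X]) D.

Definition dicocycle G D : bool :=
  cocycle G D &&
  [exists X : {set vertex G}, (D == cut X) &&
     [forall e in D, (src G e \in X) && (tgt G e \notin X)]].

Definition acyclic G : bool := [forall C, ~~ dicycle G C].

Definition is_source G (x : vertex G) : bool :=
  nonisolated x && [forall e in edges G, tgt G e != x].

Definition is_sink G (x : vertex G) : bool :=
  nonisolated x && [forall e in edges G, src G e != x].

Definition bipolar G p : Prop :=
  [/\ p \in edges G, acyclic G &
   exists s t : vertex G,
     [/\ forall x, is_source x <-> x = s,
         forall x, is_sink x <-> x = t &
         [set s; t] = [set src G p; tgt G p]]].

Definition cyclic_bipolar G p : Prop :=
  [/\ p \in edges G,
      forall e, e \in edges G -> exists2 C, dicycle G C & e \in C &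
      forall C, dicycle G C -> p \in C].

End Digraphs.

Arguments adj {E} G F _ _.

Section Filtration.
Variables (d : Order.disp_t) (E : finOrderType d).
Implicit Types (G : digraph E) (A C D : {set E}) (a e : E) (k : nat).
Local Open Scope order_scope.

Definition is_min e A : bool := (e \in A) && [forall f in A, e <= f].

Definition min_ge A a : bool := [exists m, is_min m A && (a <= m)].

(* Increasing lists of the dual-active and of the active edges: item k of
   these lists, counted from 0, is a_(k+1), respectively a'_(k+1). *)
Definition dual_actives G : seq E :=
  sort <=%O (enum [set e | [exists D, dicocycle G D && is_min e D]]).

Definition actives G : seq E :=
  sort <=%O (enum [set e | [exists C, dicycle G C && is_min e C]]).

(* F_k; the [None] branch is reached for k = iota, the number of dual-active
   edges (and for the irrelevant values k > iota). *)
Definition filtration G k : {set E} :=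
  if onth (dual_actives G) k is Some a then
    edges G :\: \bigcup_(D | dicocycle G D && min_ge D a) D
  else edges G.

(* F'_k, with the same convention. *)
Definition cyclic_filtration G k : {set E} :=
  if onth (actives G) k is Some a then
    \bigcup_(C | dicycle G C && min_ge C a) C
  else set0.

End Filtration.

(* Main.v *)
Require Import Defs.
From mathcomp Require Import all_boot all_order.
Set Implicit Arguments.
Unset Strict Implicit.
Unset Printing Implicit Defensive.
Import Order.TTheory.

(** Let [P] be the family of directed cocycles, or of directed cycles, of [G],
    and let [a] be the minimum of a member of [P].  Put [V] for the union of
    the members of [P] all of whose edges are at least [a], and [U] for the
    union of those all of whose edges are greater than [a].  These are the
    unions that define the two consecutive terms of the filtration at [a]
    ([union_from_ge], [union_from_gt]), so that the active minor at [a] has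
    edge set [V :\: U], whose minimum is [a] ([level_min]).

    Everything else rests on one remark ([level_hits_min]): if a set [B] of
    edges of the minor meets a member [A] of [P] that is contained in
    [U :|: B], then [a] belongs to [B].  Indeed the edges of [A] are at least
    [a]; if [a] were not among them they would all be greater than [a], so [A]
    would be contained in [U], which is disjoint from [B].  Hence [a] is in
    [A], and it is not in [U].

    It remains to see that directed cuts and directed cycles pass between [G]
    and the minor.  From [G] to the minor this is direct: a directed cut
    contained in [V] restricts to a directed cut of the minor, and a directed
    cycle contained in [V] becomes a closed directed walk.  So every edge of
    the minor is in a directed cut, respectively in a directed cycle.
    Conversely, let [B] be a directed cut or a directed cycle of the minor, and
    [e] an edge of [B].
    - For cuts, the deleted set [U] is a union of directed cuts.  They order
      the vertices of [G] in such a way that each edge of [U] goes strictly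
      down and any other edge stays on its level; cutting at the level of [e],
      and along [B] inside that level, yields a directed cut of [G] through [e]
      contained in [U :|: B] ([dicut_lift]), hence a directed cocycle
      ([dicocycle_in_dicut]).
    - For cycles, the contracted set [U] is a union of directed cycles, so its
      components are strongly connected, and [B] can be completed by edges of
      [U] to a closed directed walk of [G] ([connect_contract]), which contains
      a directed cycle through [e] ([dicycle_through]).
    By the remark, [a] is in [B].  For cycles this is cyclic-bipolarity; for
    cuts, bipolarity follows by looking at the cuts around single vertices
    ([bipolar_dicuts]). *)

(** * Directed cuts *)

Section DirectedCuts.
Variable E : finType.
Implicit Types (G : digraph E) (A B C D F U : {set E}) (e f p : E).

(** The cuts of such sets are exactly the directed cuts; the empty cut is
    allowed. *)
Definition outward G (X : {set vertex G}) : bool :=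
  [forall f in edges G, (tgt G f \in X) ==> (src G f \in X)].

Lemma outwardP G (X : {set vertex G}) :
  reflect (forall f, f \in edges G -> tgt G f \in X -> src G f \in X)
          (outward X).
Proof.
apply: (iffP forall_inP) => out f fG; last by apply/implyP; apply: out.
by apply/implyP; apply: out.
Qed.

Lemma mem_cut_outward G (X : {set vertex G}) f : outward X ->
  (f \in cut X) = [&& f \in edges G, src G f \in X & tgt G f \notin X].
Proof.
move=> /outwardP outX; rewrite inE; case fG: (f \in edges G) => //=.
by move: (outX f fG); case: (tgt G f \in X); case: (src G f \in X) => // ->.
Qed.

Lemma cutC G (X : {set vertex G}) : cut (~: X) = cut X.
Proof.
by apply/setP => f; rewrite !inE; case: (src G f \in X); case: (tgt G f \in X).
Qed.

Lemma dicocycle_outward G D : dicocycle G D ->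
  exists2 X : {set vertex G}, outward X & D = cut X.
Proof.
case/andP => _ /existsP[X /andP[/eqP-> /forall_inP dirX]].
exists X => //; apply/outwardP => f fG tX; apply/negPn/negP => sX.
have /dirX/andP[] : f \in cut X by rewrite inE fG tX (negPf sX).
by rewrite tX.
Qed.

Lemma dicocycle_sub G D : dicocycle G D -> D \subset edges G.
Proof.
by case/dicocycle_outward => X _ ->; apply/subsetP => e; rewrite inE => /andP[].
Qed.

Lemma dicocycle_nonempty G D : dicocycle G D -> D != set0.
Proof. by case/andP => /minsetp/andP[]. Qed.

(** Take for [X] a directed cut through [e] with as few edges as possible.  Let
    [cut Y] be a nonempty cut contained in [cut X], directed or not, with the
    tail of [e] in [Y], which is no restriction as [Y] and its complement have
    the same cut.  Since [cut Y] is contained in [cut X], the sets [X :&: Y],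
    [X :|: Y] and [X :|: ~: Y] are again outward, and their cuts consist of the
    edges of [cut X] with tail in [Y], with head outside [Y], and with head in
    [Y].  The first of these cuts contains [e], and so does one of the other
    two.  By minimality they are equal to [cut X]: all edges of [cut X] have
    their tails in [Y], and all their heads lie on the same side of [Y].  As
    [cut Y] is nonempty this is the outside, and [cut Y] is [cut X]. *)
Lemma dicocycle_in_dicut G (X0 : {set vertex G}) e :
  outward X0 -> e \in cut X0 ->
  exists D, [/\ dicocycle G D, e \in D & D \subset cut X0].
Proof.
move=> outX0 eX0.
have [X /andP[/andP[outX eX] subX] minX] :
  exists2 X : {set vertex G},
    outward X && (e \in cut X) && (cut X \subset cut X0) &
    forall Z : {set vertex G}, outward Z -> e \in cut Z ->
      cut Z \subset cut X -> cut Z = cut X.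
  pose P (Z : {set vertex G}) :=
    outward Z && (e \in cut Z) && (cut Z \subset cut X0).
  have PX0 : P X0 by rewrite /P outX0 eX0 subxx.
  case: (@arg_minnP _ X0 P (fun Z => #|cut Z|) PX0) => X PX leX.
  exists X => // Z outZ eZ ZX; apply/eqP; rewrite eqEcard ZX leX //.
  by rewrite /P outZ eZ (subset_trans ZX) //; case/andP: PX.
exists (cut X); split=> //; rewrite /dicocycle.
have dirX f : f \in cut X -> (src G f \in X) && (tgt G f \notin X).
  by rewrite mem_cut_outward // => /and3P[_ -> ->].
apply/andP; split; last first.
  by apply/existsP; exists X; rewrite eqxx; apply/forall_inP.
apply/minsetP; split.
  by apply/andP; split; [apply/set0Pn; exists e | apply/existsP; exists X].
suff main (Y : {set vertex G}) : cut Y != set0 -> cut Y \subset cut X ->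
    src G e \in Y -> cut Y = cut X.
  move=> B /andP[B0 /existsP[Y /eqP defB]]; rewrite defB in B0 *.
  move=> sYX.
  have [sY|sY] := boolP (src G e \in Y); first exact: main.
  by rewrite -cutC main ?cutC // inE.
move=> Y0 /subsetP YX sY.
have stay f : f \in edges G -> f \notin cut X ->
    (src G f \in X) = (tgt G f \in X) /\ (src G f \in Y) = (tgt G f \in Y).
  move=> fG fX; have := contra (YX f) fX; move: fX.
  by rewrite !inE fG /= !negbK => /eqP-> /eqP->.
have eG : e \in edges G by move: eX; rewrite inE => /andP[].
have outI : outward (X :&: Y).
  apply/outwardP => f fG; rewrite !inE => /andP[tX tY].
  have [/dirX|/(stay _ fG)[-> ->]] := boolP (f \in cut X); last by rewrite tX.
  by rewrite tX /= andbF.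
have outU (Z : {set vertex G}) : (Z = Y \/ Z = ~: Y) -> outward (X :|: Z).
  move=> defZ; apply/outwardP => f fG; rewrite !inE.
  have [/dirX/andP[-> _] //|/(stay _ fG)[-> sYt]] := boolP (f \in cut X).
  by case: defZ => ->; rewrite ?inE sYt.
have cutI f : (f \in cut (X :&: Y)) = (f \in cut X) && (src G f \in Y).
  have [fG|fG] := boolP (f \in edges G); last by rewrite !inE (negPf fG).
  have [fX|fX] := boolP (f \in cut X).
    have /andP[sX tX] := dirX f fX.
    by rewrite !inE fG sX (negPf tX) /=; case: (_ \in Y).
  by rewrite !inE; have [-> ->] := stay f fG fX; rewrite eqxx andbF.
have cutU (Z : {set vertex G}) : (Z = Y \/ Z = ~: Y) ->
    forall f, (f \in cut (X :|: Z)) = (f \in cut X) && (tgt G f \notin Z).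
  move=> defZ f.
  have [fG|fG] := boolP (f \in edges G); last by rewrite !inE (negPf fG).
  have [fX|fX] := boolP (f \in cut X).
    have /andP[sX tX] := dirX f fX.
    by rewrite !inE fG sX (negPf tX) /=; case: (_ \in Z).
  rewrite !inE; have [-> sYt] := stay f fG fX.
  by case: defZ => ->; rewrite ?inE sYt eqxx andbF.
have srcY f : f \in cut X -> src G f \in Y.
  rewrite -(minX (X :&: Y)) // ?cutI ?eX ?sY //; first by case/andP.
  by apply/subsetP => g; rewrite cutI => /andP[].
have tgtZ (Z : {set vertex G}) f : (Z = Y \/ Z = ~: Y) ->
    tgt G e \notin Z -> f \in cut X -> tgt G f \notin Z.
  move=> defZ tZ; rewrite -(minX (X :|: Z)) ?outU ?cutU ?eX ?tZ //.
    by case/andP.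
  by apply/subsetP => g; rewrite cutU // => /andP[].
have [tY|tY] := boolP (tgt G e \in Y).
  case/set0Pn: Y0 => g gY; have gX := YX g gY.
  have : tgt G g \notin ~: Y.
    by apply: tgtZ (or_intror erefl) _ gX; rewrite inE negbK.
  rewrite inE negbK => tg.
  by move: gY; rewrite inE tg srcY ?eqxx ?andbF.
apply/eqP; rewrite eqEsubset; apply/andP; split; apply/subsetP => // g gX.
have gG : g \in edges G by move: gX; rewrite inE => /andP[].
by rewrite inE gG srcY // (negPf (tgtZ Y g (or_introl erefl) tY gX)).
Qed.

(** The vertices are ordered by the sets [up x] of the outward sets that contain
    [x] and whose cuts are contained in [U]: along an edge of [G] the set [up]
    can only decrease, strictly if the edge is in [U], and it is constant
    otherwise.  Take the vertices strictly above the level of [e], and those of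
    [X] on this level. *)
Lemma dicut_lift G U (X : {set vertex G}) e :
  (forall f, f \in U -> exists Z : {set vertex G},
     [/\ outward Z, f \in cut Z & cut Z \subset U]) ->
  @outward (restrict G (edges G :\: U)) X ->
  e \in @cut _ (restrict G (edges G :\: U)) X ->
  exists D, [/\ dicocycle G D, e \in D &
    D \subset U :|: @cut _ (restrict G (edges G :\: U)) X].
Proof.
set H := restrict _ _ => cutsU outX eX.
pose up (x : vertex G) :=
  [set Z : {set vertex G} | [&& outward Z, cut Z \subset U & x \in Z]].
have upS f : f \in edges G -> up (tgt G f) \subset up (src G f).
  move=> fG; apply/subsetP => Z; rewrite !inE => /and3P[outZ -> tZ].
  by rewrite outZ (outwardP _ outZ f).
have up_lt f : f \in U -> up (src G f) != up (tgt G f).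
  case/cutsU => Z [outZ fZ ZU]; apply/eqP => /setP/(_ Z).
  move: fZ; rewrite mem_cut_outward // => /and3P[_ sZ tZ].
  by rewrite !inE outZ ZU sZ (negPf tZ).
have up_eq f : f \in edges G -> f \notin U -> up (src G f) = up (tgt G f).
  move=> fG fU; apply/setP => Z; rewrite !inE.
  case outZ: (outward Z) => //=; case ZU: (cut Z \subset U) => //=.
  have : f \notin cut Z by apply: contra fU; apply: (subsetP ZU).
  by rewrite inE fG negbK => /eqP.
have /and3P[eH seX teX] : [&& e \in edges H, src G e \in X & tgt G e \notin X].
  by move: eX; rewrite mem_cut_outward.
have /and3P[eG eU _] : [&& e \in edges G, e \notin U & e \in edges G].
  by move: eH; rewrite !inE => /and3P[-> -> _].
have EH f : f \in edges G -> f \notin U -> f \in edges H.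
  by move=> fG fU; rewrite !inE fG fU.
pose Y := [set x | (up (src G e) \proper up x) ||
                   (up x == up (src G e)) && (x \in X)].
have outY : outward Y.
  apply/outwardP => f fG; rewrite !inE.
  case/orP => [lt_t|/andP[/eqP eq_t tX]].
    by rewrite (proper_sub_trans lt_t) ?upS.
  have [fU|fU] := boolP (f \in U).
    by rewrite -eq_t properEneq upS // eq_sym up_lt.
  by rewrite [up (src G f)]up_eq // eq_t eqxx (outwardP _ outX f) ?EH ?orbT.
have eY : e \in cut Y.
  rewrite mem_cut_outward // eG !inE eqxx seX orbT /=.
  by rewrite (negPf teX) andbF orbF up_eq // properE subxx.
have [D [dD eD DY]] := dicocycle_in_dicut outY eY.
exists D; split=> //; apply: subset_trans DY _; apply/subsetP => f.
rewrite inE => /andP[fG fY]; rewrite inE; case: (boolP (f \in U)) => //= fU.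
apply: contraNT fY; rewrite inE EH //= negbK => /eqP eqX.
by rewrite !inE eqX [up (src G f)]up_eq ?eqxx.
Qed.

End DirectedCuts.

(** * Directed walks *)

Section DirectedWalks.
Variable E : finType.
Implicit Types (G : digraph E) (A B C D F U : {set E}) (e f p : E).

Definition dstep G A : rel (vertex G) := fun x y =>
  [exists e in edges G :&: A, (src G e == x) && (tgt G e == y)].
Arguments dstep : clear implicits.

Lemma dstepP G A x y :
  reflect (exists e, [/\ e \in edges G, e \in A, src G e = x & tgt G e = y])
          (dstep G A x y).
Proof.
apply: (iffP exists_inP) => [[e]|[e [eG eA <- <-]]].
  by rewrite inE => /andP[eG eA] /andP[/eqP sx /eqP ty]; exists e.
by exists e; rewrite ?inE ?eG ?eA ?eqxx.
Qed.

Lemma connect_dstepS G A B x y : A \subset B ->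
  connect (dstep G A) x y -> connect (dstep G B) x y.
Proof.
move=> /subsetP AB; apply: connect_sub => {}x {}y /dstepP[e [eG eA sx ty]].
by apply/connect1/dstepP; exists e; split=> //; apply: AB.
Qed.

Lemma dicycle_connect G C e : dicycle G C -> e \in C ->
  connect (dstep G C) (tgt G e) (src G e).
Proof.
case/and3P => _ /subsetP CG /existsP[s /and3P[/eqP defC cyc _]] eC.
have memC f : (f \in C) = (f \in tval s) by rewrite {1}defC inE.
have /rot_to[i s' def_s] : e \in tval s by rewrite -memC.
have walk : forall q f g, path (fun e f => tgt G e == src G f) f (rcons q g) ->
    {subset q <= C} -> connect (dstep G C) (tgt G f) (src G g).
  elim=> [|h q IHq] f g /= /andP[/eqP-> pq] qC; first exact: connect0.
  apply: (connect_trans (y := tgt G h)).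
    have hC : h \in C by apply: qC; rewrite mem_head.
    by apply/connect1/dstepP; exists h; split=> //; apply: CG.
  by apply: IHq => // k kq; apply: qC; rewrite inE kq orbT.
apply: (walk s').
  by move: cyc; rewrite -(rot_cycle i) def_s.
by move=> f fs'; rewrite memC -(mem_rot i) def_s inE fs' orbT.
Qed.

(** A directed walk from the head to the tail of [e] can be chosen without
    repeated vertices; it forms a directed cycle with [e]. *)
Lemma dicycle_through G A e : e \in edges G -> e \in A ->
  connect (dstep G A) (tgt G e) (src G e) ->
  exists C, [/\ dicycle G C, e \in C & C \subset A].
Proof.
move=> eG eA /connectP[p0 p0path].
case/shortenP: p0path => p p_path p_uniq _ lastp.
have [s [s_path sGA ts]] : exists s : seq E,
    [/\ path (fun e f => tgt G e == src G f) e s,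
        {subset s <= edges G :&: A} & map (tgt G) s = p].
  elim: p e {eG eA p_uniq lastp p0} p_path => [|y p IHp] e /=.
    by exists [::].
  case/andP=> /dstepP[f [fG fA sf tf]]; rewrite -tf => /IHp[s [sp ss ts]].
  exists (f :: s); split=> /=; rewrite ?sf ?eqxx ?sp ?ts ?tf //.
  by move=> g; rewrite !inE => /orP[/eqP->|/ss]; rewrite ?inE ?fG.
(* The tails of [e :: s] are, up to a rotation, the vertices of the walk. *)
have srcs : map (src G) s = belast (tgt G e) p.
  rewrite -ts; elim: s e s_path {sGA ts eG eA p_path p_uniq lastp p0} => //=.
  by move=> f s IHs e /andP[/eqP-> /IHs->].
have us : uniq (map (src G) (e :: s)).
  by rewrite /= srcs lastp -rcons_uniq -lastI.
have ues : uniq (e :: s) by apply: map_uniq us.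
exists [set:: e :: s]; split; first apply/and3P; first split.
- by apply/set0Pn; exists e; rewrite inE mem_head.
- by apply/subsetP => f; rewrite !inE => /orP[/eqP->|/sGA/setIP[]].
- have sz : size (e :: s) == #|[set:: e :: s]|.
    by rewrite cardsE (card_uniqP ues).
  apply/existsP; exists (Tuple sz); rewrite eqxx us andbT /= rcons_path s_path.
  by rewrite -[tgt G _](last_map (tgt G)) ts lastp /=.
- by rewrite inE mem_head.
- by apply/subsetP => f; rewrite !inE => /orP[/eqP->|/sGA/setIP[]].
Qed.

Lemma outward_connect G A (X : {set vertex G}) x y : outward X ->
  connect (dstep G A) x y -> y \in X -> x \in X.
Proof.
move=> /outwardP outX /connectP[p + ->]; elim: p x => //= z p IHp x.
case/andP=> /dstepP[e [eG _ <- tz]] /IHp zX /zX; rewrite -tz; exact: outX.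
Qed.

(** An edge entering the tail of [p] would lie in a directed cut; but this cut
    contains [p], so it has the tail of [p] on its initial side.  So the tail
    of [p] is a source, and it is the only one because the edges at any source
    form a directed cut, which contains [p].  Sinks are dual.  A directed cycle
    cannot leave an outward set and come back. *)
Lemma bipolar_dicuts G p :
  p \in edges G ->
  (forall e, e \in edges G ->
     exists2 X : {set vertex G}, outward X & e \in cut X) ->
  (forall X : {set vertex G}, outward X -> cut X != set0 -> p \in cut X) ->
  bipolar G p.
Proof.
move=> pG in_cut p_in_cut.
have src_tgt e : e \in edges G ->
    tgt G e != src G p /\ src G e != tgt G p.
  move=> eG; have [X outX eX] := in_cut e eG.
  have: p \in cut X by apply: p_in_cut => //; apply/set0Pn; exists e.
  move: eX; rewrite !mem_cut_outward // => /and3P[_ se te] /and3P[_ sp tp].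
  by split; apply/eqP => eqv; [rewrite eqv sp in te | rewrite -eqv se in tp].
split=> //.
  apply/forallP => C; apply/negP => dC; have /and3P[C0 /subsetP CG _] := dC.
  have /set0Pn[e eC] := C0; have [X outX] := in_cut e (CG e eC).
  rewrite mem_cut_outward // => /and3P[_ sX]; apply/negP; rewrite negbK.
  exact: outward_connect outX (dicycle_connect dC eC) sX.
exists (src G p), (tgt G p); split=> // x; split.
- case/andP=> /exists_inP[e eG ex] /forall_inP src_x.
  have /eqP se : src G e == x by rewrite (negPf (src_x e eG)) orbF in ex.
  have outx : outward [set x].
    by apply/outwardP => f fG; rewrite !inE (negPf (src_x f fG)).
  have : p \in cut [set x].
    apply: p_in_cut => //; apply/set0Pn; exists e.
    by rewrite mem_cut_outward // eG !inE se eqxx src_x.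
  by rewrite mem_cut_outward // !inE => /and3P[_ /eqP].
- move=> ->; apply/andP; split.
    by apply/exists_inP; exists p => //; rewrite eqxx.
  by apply/forall_inP => e /src_tgt[].
- case/andP=> /exists_inP[e eG ex] /forall_inP tgt_x.
  have /eqP te : tgt G e == x by rewrite (negPf (tgt_x e eG)) in ex.
  have outx : outward (~: [set x]).
    by apply/outwardP => f fG; rewrite !inE tgt_x.
  have : p \in cut (~: [set x]).
    apply: p_in_cut => //; apply/set0Pn; exists e.
    by rewrite mem_cut_outward // eG !inE te eqxx tgt_x.
  by rewrite mem_cut_outward // !inE negbK => /and3P[_ _ /eqP].
- move=> ->; apply/andP; split.
    by apply/exists_inP; exists p => //; rewrite eqxx orbT.
  by apply/forall_inP => e /src_tgt[].
Qed.

End DirectedWalks.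
Arguments dstep {E} G A _ _.

(** * Contraction and restriction *)

Section Contraction.
Variable E : finType.
Implicit Types (G : digraph E) (A B C D F U : {set E}) (e f p : E).

Definition component G F (x : vertex G) : vertex (contract G F) :=
  [set y | connect (adj G F) x y].

Lemma componentP G F (x y : vertex G) :
  reflect (component F x = component F y) (connect (adj G F) x y).
Proof.
have sym : connect_sym (adj G F).
  apply: sym_connect_sym => u v; rewrite /adj.
  by apply/exists_inP/exists_inP => -[e eF]; rewrite orbC; exists e.
apply: (iffP idP) => [xy|/setP/(_ y)]; last by rewrite !inE connect0.
by apply/setP => z; rewrite !inE (same_connect sym xy).
Qed.

Lemma component_edge G F f : f \in edges G -> f \in F ->
  component F (src G f) = component F (tgt G f).
Proof.
move=> fG fF; apply/componentP/connect1/exists_inP.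
by exists f; rewrite ?inE ?fG ?fF ?eqxx.
Qed.

Lemma outward_preim G F (Y : {set vertex (contract G F)}) :
  outward Y ->
  outward (component F @^-1: Y) /\ cut (component F @^-1: Y) = cut Y.
Proof.
move=> /outwardP outY; split.
  apply/outwardP => f fG; rewrite !inE.
  have [fF|fF] := boolP (f \in F); first by rewrite component_edge.
  by apply: outY; rewrite !inE fF.
apply/setP => f; rewrite !inE.
case fG: (f \in edges G); rewrite ?andbF //=.
by case: (boolP (f \in F)) => //= fF; rewrite component_edge ?eqxx.
Qed.

(** As [cut X] avoids [F], the set [X] is a union of components of [F]. *)
Lemma outward_image G F (X : {set vertex G}) :
  [disjoint cut X & F] -> outward X ->
  exists2 Y : {set vertex (contract G F)}, outward Y & cut Y = cut X.
Proof.
move=> XF /outwardP outX.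
have closedX : closed (adj G F) (mem X).
  move=> x y /exists_inP[e]; rewrite inE => /andP[eG eF] xy.
  have : e \notin cut X by rewrite (disjointFl XF eF).
  rewrite inE eG negbK => /eqP eX.
  by case/orP: xy => /andP[/eqP<- /eqP<-]; rewrite ?inE eX.
pose Y : {set vertex (contract G F)} := component F @: X.
have memY x : (component F x \in Y) = (x \in X).
  apply/imsetP/idP => [[y yX /componentP xy]|xX]; last by exists x.
  by have := closed_connect closedX xy; rewrite /= yX.
exists Y.
  apply/outwardP => f; rewrite inE => /andP[_ fG].
  by rewrite [src _ _ \in _]memY [tgt _ _ \in _]memY; apply: outX.
apply/setP => f; rewrite [LHS]inE [src _ _ \in _]memY [tgt _ _ \in _]memY.
rewrite !inE; case: (boolP (f \in F)) => //= /(disjointFl XF).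
by rewrite inE.
Qed.

Lemma contract_connect G F A x y : connect (dstep G A) x y ->
  connect (dstep (contract G F) A) (component F x) (component F y).
Proof.
move=> /connectP[p + ->]; elim: p x => [|z p IHp] x //=.
case/andP=> /dstepP[e [eG eA <- tz]] /IHp; apply: connect_trans; rewrite -tz.
have [eF|eF] := boolP (e \in F); first by rewrite component_edge.
by apply/connect1/dstepP; exists e; rewrite inE eF eG.
Qed.

(** The assumption makes the components of [F] strongly connected by edges of
    [F :|: A], so that consecutive edges of a walk of the contraction can be
    joined in [G]. *)
Lemma connect_contract G F A (x y : vertex G) :
  (forall f, f \in edges G -> f \in F ->
     connect (dstep G (F :|: A)) (tgt G f) (src G f)) ->
  connect (dstep (contract G F) A) (component F x) (component F y) ->
  connect (dstep G (F :|: A)) x y.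
Proof.
move=> backF.
have sameF u v : component F u = component F v ->
    connect (dstep G (F :|: A)) u v.
  move/componentP; apply: connect_sub => {}u {}v /exists_inP[f].
  rewrite inE => /andP[fG fF] /orP[] /andP[/eqP<- /eqP<-]; last exact: backF.
  by apply/connect1/dstepP; exists f; rewrite inE fF.
case/connectP => p; elim: p x => [|z p IHp] x /=.
  by move=> _ /esym/sameF.
case/andP=> /dstepP[f [fGF fA sx <-]] pp lastp.
apply: connect_trans (sameF _ _ (esym sx)) _.
apply: (connect_trans (y := tgt G f)); last exact: IHp.
move: fGF; rewrite inE => /andP[_ fG].
by apply/connect1/dstepP; exists f; rewrite inE fA orbT.
Qed.

Lemma connect_restrict G F A (x y : vertex G) : A \subset F ->
  connect (dstep (restrict G F) A) x y = connect (dstep G A) x y.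
Proof.
move=> /subsetP AF; apply: eq_connect => u v.
apply/dstepP/dstepP => -[e [eG eA su tv]]; exists e; split=> //.
  by move: eG; rewrite inE => /andP[].
by rewrite inE eG AF.
Qed.

End Contraction.

(** * Unions of sets with large minimum *)

Definition union_within (E : finType) (P : pred {set E}) (Q : pred E) :
    {set E} :=
  \bigcup_(A | P A && [forall x in A, Q x]) A.

Notation union_ge P a := (union_within P (fun x => (a <= x)%O)).
Notation union_gt P a := (union_within P (fun x => (a < x)%O)).

Lemma mem_union_within (E : finType) (P : pred {set E}) (Q : pred E) e :
  reflect (exists A, [/\ P A, e \in A & A \subset union_within P Q])
          (e \in union_within P Q).
Proof.
apply: (iffP idP) => [/bigcupP[A PA eA]|[A [_ eA /subsetP]]]; last exact.
exists A; split=> //; first by case/andP: PA.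
exact: bigcup_sup.
Qed.

Section Levels.
Variables (d : Order.disp_t) (E : finOrderType d).
Implicit Types (G : digraph E) (A B : {set E}) (P : pred {set E})
  (a e : E).
Local Open Scope order_scope.

(** Up to conversion, these are the dual-active edges for [P := dicocycle G] and
    the active edges for [P := dicycle G]. *)
Definition minima P : seq E :=
  sort <=%O (enum [set e | [exists A, P A && is_min e A]]).

(** For the directed cycles this is the [k]-th term of the cyclic filtration;
    for the directed cocycles it is the complement of the [k]-th term of the
    other one. *)
Definition union_from P k : {set E} :=
  if onth (minima P) k is Some a then \bigcup_(A | P A && min_ge A a) A
  else set0.

Lemma mem_minima P e :
  reflect (exists2 A, P A & is_min e A) (e \in minima P).
Proof.
by rewrite mem_sort mem_enum inE; apply: (iffP existsP) => -[A];
  [case/andP; exists A | move=> PA eA; exists A; rewrite PA].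
Qed.

Lemma exists_min A : A != set0 -> exists m, is_min m A.
Proof.
case/set0Pn => e eA; case: (@arg_minP _ _ _ e (mem A) id eA) => m mA minm.
by exists m; rewrite /is_min; apply/andP; split=> //; apply/forall_inP.
Qed.

Lemma min_ge_lb A a : A != set0 -> min_ge A a = [forall x in A, a <= x].
Proof.
move=> A0; apply/existsP/forall_inP.
  by case=> m /andP[/andP[_ /forall_inP mA] am] x /mA; apply: le_trans.
have [m mA] := exists_min A0 => aA; exists m; rewrite mA aA //.
by case/andP: mA.
Qed.

Lemma union_from_ge P k a : (forall A, P A -> A != set0) ->
  onth (minima P) k = Some a -> union_from P k = union_ge P a.
Proof.
move=> P0; rewrite /union_from => ->; apply: eq_bigl => A.
by case PA: (P A) => //=; rewrite min_ge_lb ?P0.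
Qed.

(** The minimum of a member of [P] is an entry of the sorted list [minima P], so
    it is greater than the [k]-th entry if and only if it is at least the next
    one. *)
Lemma union_from_gt P k a : (forall A, P A -> A != set0) ->
  onth (minima P) k = Some a -> union_from P k.+1 = union_gt P a.
Proof.
move=> P0 kth_a; set s := minima P.
have ks : (k < size s)%N by rewrite -onthTE kth_a.
have ka : nth a s k = a by apply: onth_nth kth_a.
have sorted_s : sorted <%O s by rewrite sort_lt_sorted enum_uniq.
have next A : P A -> [forall x in A, a < x] =
    (if onth s k.+1 is Some b then min_ge A b else false).
  move=> PA; have [m mA] := exists_min (P0 A PA).
  have ms : m \in s by apply/mem_minima; exists A.
  have /andP[mA' /forall_inP mle] := mA.
  have -> : [forall x in A, a < x] = (k < index m s)%N.
    rewrite -(lt_sorted_ltn_nth a sorted_s) ?inE ?index_mem // nth_index // ka.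
    apply/forall_inP/idP => [|am x /mle]; [exact | exact: lt_le_trans].
  case next_b: (onth s k.+1) => [b|].
    have k1s : (k.+1 < size s)%N by rewrite -onthTE next_b.
    rewrite -(lt_sorted_leq_nth a sorted_s) ?inE ?index_mem // nth_index //.
    rewrite (onth_nth a _ _ _ next_b) min_ge_lb ?P0 //.
    apply/idP/forall_inP => [bm x /mle|]; [exact: le_trans | exact].
  have s_k : (size s <= k.+1)%N by rewrite -onthNE next_b.
  by apply/negbTE; rewrite -leqNgt -ltnS (leq_trans _ s_k) // index_mem.
rewrite /union_from /union_within -/s; case next_b: (onth _ _) => [b|].
  by apply: eq_bigl => A; case PA: (P A) => //=; rewrite next ?next_b.
by rewrite big_pred0 // => A; case PA: (P A) => //=; rewrite next ?next_b.
Qed.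

Lemma union_gt_sub P a : union_gt P a \subset union_ge P a.
Proof.
apply/bigcupsP => A /andP[PA /forall_inP aA]; apply: bigcup_sup.
by rewrite PA; apply/forall_inP => x /aA/ltW.
Qed.

Lemma lb_union_ge P a e : e \in union_ge P a -> a <= e.
Proof. by case/bigcupP => A /andP[_ /forall_inP]; apply. Qed.

Lemma level_min P a : a \in minima P ->
  is_min a (union_ge P a :\: union_gt P a).
Proof.
case/mem_minima => A PA /andP[aA /forall_inP leA]; apply/andP; split.
  rewrite inE; apply/andP; split.
    by apply/bigcupP => -[B /andP[_ /forall_inP ltB] /ltB]; rewrite ltxx.
  by apply/bigcupP; exists A => //; rewrite PA; apply/forall_inP.
by apply/forall_inP => f /setDP[/lb_union_ge].
Qed.

(** This is how directed cuts and cycles of an active minor are seen to contain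
    [a]: for such a set [B] of edges, it is enough to find a directed cocycle
    or cycle of [G] that meets [B] and otherwise uses edges of [union_gt P a]
    only. *)
Lemma level_hits_min P a A B e :
  P A -> e \in A -> e \in B -> B \subset union_ge P a :\: union_gt P a ->
  A \subset union_gt P a :|: B -> a \in B.
Proof.
move=> PA eA eB /subsetP subB /subsetP subA.
have agt : a \notin union_gt P a.
  by apply/bigcupP => -[C /andP[_ /forall_inP ltC] /ltC]; rewrite ltxx.
have leA x : x \in A -> a <= x.
  case/subA/setUP => [/(subsetP (union_gt_sub P a))|/subB/setDP[+ _]];
    exact: lb_union_ge.
suff /subA : a \in A by rewrite inE (negPf agt).
apply/negPn/negP => aA; have /setDP[_ /negP[]] := subB e eB.
apply/bigcupP; exists A => //; rewrite PA; apply/forall_inP => x xA.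
by rewrite lt_neqAle leA // andbT; apply: contraNneq aA => ->.
Qed.

Lemma onth_minima P k a : onth (minima P) k = Some a -> a \in minima P.
Proof. by move=> kth_a; apply/onthP; exists k. Qed.

End Levels.

(** * Active minors *)

Lemma setDD_sub (T : finType) (S U V : {set T}) : V \subset S ->
  (S :\: U) :\: (S :\: V) = V :\: U.
Proof.
move=> /subsetP VS; apply/setP => x; rewrite !inE; move: (VS x).
case: (x \in V) => [/(_ isT)->|_] /=; first by rewrite !andbT.
by case: (x \in S); case: (x \in U).
Qed.

Section ActiveMinors.
Variables (d : Order.disp_t) (E : finOrderType d) (G : digraph E).
Implicit Types (a e : E) (k : nat).

Lemma filtrationE k :
  filtration G k = edges G :\: union_from (dicocycle G) k.
Proof.
rewrite /filtration /union_from -[minima _]/(dual_actives G).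
by case: (onth _ _) => // ; rewrite setD0.
Qed.

Lemma bipolar_level a (P := dicocycle G) : a \in minima P ->
  bipolar (contract (restrict G (edges G :\: union_gt P a))
                    (edges G :\: union_ge P a)) a.
Proof.
move=> aP; set R := restrict _ _; set F := edges G :\: _.
have PG A : P A -> A \subset edges G.
  exact: dicocycle_sub.
have geG : union_ge P a \subset edges G by apply/bigcupsP => A /andP[/PG].
have edgesE : edges (contract R F) = union_ge P a :\: union_gt P a.
  by rewrite /= (setIidPr (subsetDl _ _)) setDD_sub.
have cuts (Q : pred E) e : e \in union_within P Q ->
    exists X : {set vertex G},
      [/\ outward X, e \in cut X & cut X \subset union_within P Q].
  case/mem_union_within => D [/dicocycle_outward[X outX ->] eX sX].
  by exists X.
apply: bipolar_dicuts; rewrite ?edgesE.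
- by case/andP: (level_min aP).
- move=> e /setDP[/cuts[X [outX eX /subsetP sX]] egt].
  have outXR : @outward _ R X.
    apply/outwardP => f; rewrite inE => /andP[fG _]; exact: (outwardP _ outX).
  have cutXR f : (f \in @cut _ R X) = (f \in cut X) && (f \notin union_gt P a).
    by rewrite !inE; case: (f \in edges G) => //=; rewrite andbT andbC.
  have disj : [disjoint @cut _ R X & F].
    apply/pred0P => f /=; rewrite cutXR !inE; apply/negP.
    by case/andP=> /andP[fX _] /andP[/negP[]]; apply: sX; rewrite inE.
  have [Y outY defY] := outward_image disj outXR.
  by exists Y => //; rewrite defY cutXR eX.
- move=> Y outY /set0Pn[e eY]; have [outX defX] := outward_preim outY.
  have eX := eY; rewrite -defX in eX.
  have [D [PD eD sD]] := dicut_lift (@cuts _) outX eX.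
  apply: (level_hits_min PD eD eY); last by rewrite -defX.
  by rewrite -edgesE; apply/subsetP => f; rewrite inE => /andP[].
Qed.

Lemma cyclic_bipolar_level a (P := dicycle G) : a \in minima P ->
  cyclic_bipolar (contract (restrict G (union_ge P a)) (union_gt P a)) a.
Proof.
move=> aP; set R := restrict _ _; set F := union_gt P a.
have PG A : P A -> A \subset edges G by case/and3P.
have geG : union_ge P a \subset edges G by apply/bigcupsP => A /andP[/PG].
have edgesE : edges (contract R F) = union_ge P a :\: F.
  by rewrite /= (setIidPr geG).
split; rewrite ?edgesE; first by case/andP: (level_min aP).
  move=> e eGF; have /setDP[/mem_union_within[C [PC eC sC]] _] := eGF.
  have := dicycle_connect PC eC; rewrite -(connect_restrict _ _ sC).
  move=> /(contract_connect F) => conn.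
  have eK : e \in edges (contract R F) by rewrite edgesE.
  by have [C' [dC' eC' _]] := dicycle_through eK eC conn; exists C'.
move=> C dC; have /and3P[/set0Pn[e eC] sCK _] := dC.
have sC : C \subset union_ge P a :\: F by rewrite -edgesE.
have sFC : F :|: C \subset union_ge P a.
  by rewrite subUset union_gt_sub (subset_trans sC) ?subsetDl.
have eFC : e \in F :|: C by rewrite inE eC orbT.
have conn : connect (dstep G (F :|: C)) (tgt G e) (src G e).
  rewrite -(connect_restrict _ _ sFC).
  apply: (@connect_contract _ R); last exact: dicycle_connect dC eC.
  move=> f _ /mem_union_within[C' [PC' fC' sC']].
  rewrite [in X in is_true X]connect_restrict //.
  by apply: connect_dstepS (dicycle_connect PC' fC'); rewrite subsetU ?sC'.
have eG : e \in edges G by apply: (subsetP geG); apply: (subsetP sFC).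
have [A [PA eA sA]] := dicycle_through eG eFC conn.
exact: level_hits_min PA eA eC sC sA.
Qed.

End ActiveMinors.

Theorem proposition3p5 (d : Order.disp_t) (E : finOrderType d)
    (G : digraph E) (hG : connected_digraph G) :
  (forall (k : nat) (a : E), onth (dual_actives G) k = Some a ->
     bipolar (contract (restrict G (filtration G k.+1)) (filtration G k)) a /\
     is_min a (filtration G k.+1 :\: filtration G k)) /\
  (forall (k : nat) (a : E), onth (actives G) k = Some a ->
     cyclic_bipolar
       (contract (restrict G (cyclic_filtration G k))
                 (cyclic_filtration G k.+1)) a /\
     is_min a (cyclic_filtration G k :\: cyclic_filtration G k.+1)).
Proof.
split=> k a kth_a; have aP := onth_minima kth_a.
  have P0 A : dicocycle G A -> A != set0 by apply: dicocycle_nonempty.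
  rewrite !filtrationE (union_from_ge P0 kth_a) (union_from_gt P0 kth_a).
  split; first exact: bipolar_level.
  have geG : union_ge (dicocycle G) a \subset edges G.
    by apply/bigcupsP => A /andP[/dicocycle_sub].
  by rewrite setDD_sub //; apply: level_min.
have P0 A : dicycle G A -> A != set0 by case/and3P.
have cE j : cyclic_filtration G j = union_from (dicycle G) j by [].
rewrite !cE (union_from_ge P0 kth_a) (union_from_gt P0 kth_a).
by split; [apply: cyclic_bipolar_level | apply: level_min].
Qed.
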